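(* Let $g\in\mathbb{R}[x,y]$ and let $\mathcal{C}=\{g=0\}\subset\mathbb{R}^2$ be in general position (as defined in the context). Let $(\{x_i\}_{i=1}^n,\{y_{ij}\},L,R)$ be a data for $\mathcal{C}$ and let $d=\deg(g)$. Let $G$ be the graph constructed from this data as described in the context. Then the geometric realization of $G$ (with each edge realized as the straight segment between its endpoints in $\mathbb{R}^2$) is isotopic to $\mathcal{C}$ in the region $[x_1,x_n]\times\mathbb{R}$.
   Context: Let $\pi:\mathcal{C}\to\mathbb{R}$, $\pi(x,y)=x$. General position means: $\mathcal{C}$ is generically smooth (singular at only finitely many points), $\pi$ has finite fibers, and any two distinct critical points of $\pi$ lie in different fibers of $\pi$. A point of $\mathcal{C}$ is a critical point of $\pi$ if $g_y=\partial g/\partial y$ vanishes there (the point is singular or has a vertical tangent line); other points of $\mathcal{C}$ are regular. A critical value is the image under $\pi$ of a critical point; all other real numbers are regular values. A good partition for $\mathcal{C}$ is a finite set $x_1<\dots<x_n$ of real numbers, $n\ge 2$, such that for every critical value $x$ of $\pi$ there is an $i$ with $x=x_i$ and $x_{i-1},x_{i+1}$ (which must exist) regular values. Write $\pi^{-1}(x_i)=\{y_{i1}<\dots<y_{ir_i}\}$, $0\le r_i\le d$ (points of the fiber are identified with their $y$-coordinates). Branches (standing convention, part of the setting): over each interval $(x_i,x_{i+1})$, $1\le i\le n-1$, the number of real roots of $g(x,-)$ is a constant $\rho_i$, the roots are given by continuous functions $\varphi_{i,1}<\dots<\varphi_{i,\rho_i}:(x_i,x_{i+1})\to\mathbb{R}$,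 and these extend continuously to $[x_i,x_{i+1}]$, with values at the endpoints in the fibers over $x_i$ and $x_{i+1}$. The number of half-branches to the right at $(x_i,y_{ij})$ is $\#\{k:\varphi_{i,k}(x_i)=y_{ij}\}$, and the number of half-branches to the left is $\#\{k:\varphi_{i-1,k}(x_i)=y_{ij}\}$. For $i=1$ (left) and $i=n$ (right) the branches over a sufficiently small interval to the left of $x_1$, respectively to the right of $x_n$, are used; since $x_1$ and $x_n$ are regular values these numbers equal $1$. A data for $\mathcal{C}$ is a tuple $(\{x_i\}_{i=1}^n,\{y_{ij}\},L,R)$ where $\{x_i\}$ is a good partition, $\{y_{ij}\}$ are the points of the fibers $\pi^{-1}(x_i)=\{y_{i1}<\dots<y_{ir_i}\}$, $1\le i\le n$, and $L,R\in\mathbb{N}_0^{n\times d}$ are such that $L_{ij}$ (resp. $R_{ij}$) is the number of half-branches to the left (resp. right) at $(x_i,y_{ij})$ for $1\le j\le r_i$, and $L_{ij}=R_{ij}=0$ for $j>r_i$. One has $\sum_k R_{i,k}=\sum_k L_{i+1,k}$ for $1\le i\le n-1$. Construction of $G$: the vertices are the points $(x_i,y_{ij})$. For $i=1,\dots,n-1$ and, for each $i$, $j=1,2,\dots$ in increasing order: while $R_{ij}>0$, let $k$ be the smallest index with $L_{i+1,k}>0$, add an edge joining $(x_i,y_{ij})$ with $(x_{i+1},y_{i+1,k})$, and decrease both $R_{ij}$ and $L_{i+1,k}$ by $1$. Isotopic in the region $[x_1,x_n]\times\mathbb{R}$ means: there is a continuous map $F:[x_1,x_n]\times\mathbb{R}\times[0,1]\to[x_1,x_n]\times\mathbb{R}$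 such that $F(-,0)$ is the identity, $F(-,t)$ is an embedding for every $t$, and $F(-,1)$ maps the geometric realization of $G$ onto $\mathcal{C}\cap([x_1,x_n]\times\mathbb{R})$. *)

(* Defs.v *)
(* MathComp-Analysis *)
From HB Require Import structures.
From mathcomp Require Import all_boot all_order all_algebra.
From mathcomp Require Import all_classical all_reals topology normedtype.

Set Implicit Arguments.
Unset Strict Implicit.
Unset Printing Implicit Defensive.

Import Order.TTheory GRing.Theory Num.Theory.
Import numFieldNormedType.Exports.

Local Open Scope classical_set_scope.
Local Open Scope ring_scope.

(* An element g of R[x,y] is g : {poly {poly R}}, with the convention of
   polyXY: the outer variable is x, the coefficients are polynomials in y, and
   g.[a, b] is the value at x = a, y = b. *)
Section Curve.
Variables (R : realType) (g : {poly {poly R}}).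

Definition totdeg : nat :=
  \max_(i < size g) \max_(j < size (g`_i)%R | (g`_i`_j != 0)%R) (i + j).

Definition dx : {poly {poly R}} := g^`().
Definition dy : {poly {poly R}} := map_poly (@deriv R) g.

Definition curve : set (R * R) := [set p | g.[p.1, p.2] = 0].

Definition singular_pt (p : R * R) : Prop :=
  [/\ curve p, dx.[p.1, p.2] = 0 & dy.[p.1, p.2] = 0].

Definition critical_pt (p : R * R) : Prop := curve p /\ dy.[p.1, p.2] = 0.

Definition critical_value (a : R) : Prop := exists2 p, critical_pt p & p.1 = a.
Definition regular_value (a : R) : Prop := ~ critical_value a.

Record general_position : Prop := {
  gp_smooth : finite_set [set p | singular_pt p];
  gp_fibers : forall a, finite_set [set p | curve p /\ p.1 = a];
  gp_critical : forall p q,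
    critical_pt p -> critical_pt q -> p <> q -> p.1 <> q.1 }.

(* The points are x ord0 < ... < x ord_max; there are m.+1 >= 2 of them. *)
Record good_partition (m : nat) (x : 'I_m.+1 -> R) : Prop := {
  gpa_size : (0 < m)%N;
  gpa_incr : forall i j : 'I_m.+1, (i < j)%N -> x i < x j;
  gpa_critical : forall a, critical_value a ->
    exists i i' i'' : 'I_m.+1,
      [/\ i' = i.+1 :> nat, i'' = i'.+1 :> nat, a = x i',
          regular_value (x i) & regular_value (x i'')] }.

Record branches (a b : R) (rho : nat) (phi : 'I_rho -> R -> R) : Prop := {
  br_cont : forall k, {within `]a, b[%classic, continuous (phi k)};
  br_incr : forall (k l : 'I_rho) u,
    (k < l)%N -> a < u < b -> phi k u < phi l u;
  br_roots : forall u v,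
    a < u < b -> curve (u, v) <-> exists k, v = phi k u }.

Record closed_branches (a b : R) (rho : nat) (phi : 'I_rho -> R -> R) : Prop := {
  cbr_branches : branches a b phi;
  cbr_cont : forall k, {within `[a, b]%classic, continuous (phi k)};
  cbr_left : forall k, curve (a, phi k a);
  cbr_right : forall k, curve (b, phi k b) }.

(* The m intervals of a partition into m.+1 points: interval i lies between
   the points of indices lend i and rend i, whose values are i and i.+1. *)
Definition lend (m : nat) (i : 'I_m) : 'I_m.+1 := widen_ord (leqnSn m) i.
Definition rend (m : nat) (i : 'I_m) : 'I_m.+1 := lift ord0 i.

Definition branch_system (m : nat) (x : 'I_m.+1 -> R)
    (rho : 'I_m -> nat) (phi : forall i, 'I_(rho i) -> R -> R) : Prop :=
  forall i, closed_branches (x (lend i)) (x (rend i)) (phi i).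

Definition count_at (rho : nat) (phi : 'I_rho -> R -> R) (a v : R) : nat :=
  #|[set k : 'I_rho | phi k a == v]%SET|.

(* Outside [x_1, x_n] branches need not extend to the end point (they may be
   unbounded), so the ones ending at a point are detected by their limit. *)
Definition count_lim (rho : nat) (phi : 'I_rho -> R -> R)
    (F : set_system R) (v : R) : nat :=
  #|[set k : 'I_rho | `[< phi k u @[u --> F] --> v >]]%SET|.

Definition row_of_counts (d : nat) (s : seq R) (cnt : R -> nat)
    (row : 'I_d -> nat) : Prop :=
  forall j, row j = if (j < size s)%N then cnt s`_j else 0%N.

(* Y i is the list y_{i1} < ... < y_{i r_i}, so that r_i = size (Y i). *)
Record curve_data (m : nat) (x : 'I_m.+1 -> R)
    (rho : 'I_m -> nat) (phi : forall i, 'I_(rho i) -> R -> R)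
    (Y : 'I_m.+1 -> seq R) (Lh Rh : 'M[nat]_(m.+1, totdeg)) : Prop := {
  cd_partition : good_partition x;
  cd_sorted : forall i, sorted <%R (Y i);
  cd_fiber : forall i v, v \in Y i <-> curve (x i, v);
  cd_left : forall i : 'I_m,
    row_of_counts (Y (rend i)) (count_at (phi i) (x (rend i))) (Lh (rend i));
  cd_right : forall i : 'I_m,
    row_of_counts (Y (lend i)) (count_at (phi i) (x (lend i))) (Rh (lend i));
  cd_first : exists (e : R) (r : nat) (psi : 'I_r -> R -> R),
    [/\ 0 < e, branches (x ord0 - e) (x ord0) psi &
        row_of_counts (Y ord0) (count_lim psi (x ord0)^'-) (Lh ord0)];
  cd_last : exists (e : R) (r : nat) (psi : 'I_r -> R -> R),
    [/\ 0 < e, branches (x ord_max) (x ord_max + e) psi &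
        row_of_counts (Y ord_max) (count_lim psi (x ord_max)^'+)
          (Rh ord_max)] }.

End Curve.

(* The inner loop: it links j to the smallest k with l_k > 0, m times, and
   returns the links with what remains of l. (If l is exhausted, find returns
   an index out of bounds; this does not occur for data of a curve, where the
   two rows have the same sum.) *)
Fixpoint link (j m : nat) (l : seq nat) : seq (nat * nat) * seq nat :=
  if m is m'.+1 then
    let k := find (ltn 0%N) l in
    let: (e, l') := link j m' (set_nth 0%N l k (nth 0%N l k).-1) in
    ((j, k) :: e, l')
  else ([::], l).

Fixpoint link_rows (j : nat) (r l : seq nat) : seq (nat * nat) :=
  if r is m :: r' then
    let: (e, l') := link j m l in e ++ link_rows j.+1 r' l'
  else [::].

Definition row_seq (m d : nat) (A : 'M[nat]_(m, d)) (i : 'I_m) : seq nat :=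
  [seq A i j | j <- enum 'I_d].

Section Graph.
Variable R : realType.

Record plane_graph : Type := PlaneGraph {
  vertices : seq (R * R);
  edges : seq ((R * R) * (R * R)) }.

Definition segment (p q : R * R) : set (R * R) :=
  [set (line_path p.1 q.1 t, line_path p.2 q.2 t) | t in `[0, 1]%classic].

Definition realization (G : plane_graph) : set (R * R) :=
  [set p | p \in vertices G] `|`
  [set p | exists2 e, e \in edges G & segment e.1 e.2 p].

Definition data_graph (m d : nat) (x : 'I_m.+1 -> R) (Y : 'I_m.+1 -> seq R)
    (Lh Rh : 'M[nat]_(m.+1, d)) : plane_graph :=
  PlaneGraph
    [seq (x i, y) | i <- enum 'I_m.+1, y <- Y i]
    [seq ((x (lend i), (Y (lend i))`_jk.1), (x (rend i), (Y (rend i))`_jk.2))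
       | i <- enum 'I_m,
         jk <- link_rows 0 (row_seq Rh (lend i)) (row_seq Lh (rend i))].

Definition strip (a b : R) : set (R * R) := [set p | a <= p.1 <= b].

(* f restricted to W is a homeomorphism onto its image. *)
Definition embedding_on (W : set (R * R)) (f : R * R -> R * R) : Prop :=
  {within W, continuous f} /\
  exists h : R * R -> R * R,
    (forall p, W p -> h (f p) = p) /\ {within f @` W, continuous h}.

Definition isotopic_in (W S T : set (R * R)) : Prop :=
  exists F : (R * R) * R -> R * R,
    [/\ {within W `*` `[0, 1]%classic, continuous F},
        F @` (W `*` `[0, 1]%classic) `<=` W,
        forall p : R * R, W p -> F (p, 0) = p,
        forall t : R, 0 <= t <= 1 -> embedding_on W (fun p => F (p, t)) &
        [set F (p, 1) | p in S] = T].

End Graph.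

(* Main.v *)
(* Over each interval [x_i, x_i+1] the edges of G are the chords l_k of the
   branches phi_k: the greedy matching pairs two sorted lists of fiber points,
   hence is the unique monotone one, which is also what the branches do. Each
   interval has a regular end, where g_y <> 0 keeps distinct branches apart, so
   the chords are strictly ordered inside the interval. For fixed x, let D(x, -)
   interpolate the displacements phi_k(x) - l_k(x) linearly between the nodes
   l_k(x), constantly outside them. Then y + D(x, y) is strictly increasing in y
   and D is continuous on the whole plane: as x tends to some x_i the
   displacements tend to 0, hence so does D, even where chords merge and the
   slopes blow up. The isotopy is (x, y, t) |-> (x, y + t D(x, y)). *)

Require Import Defs.
From mathcomp Require Import all_boot all_order all_algebra.
From mathcomp Require Import all_classical all_reals topology normedtype.
From mathcomp Require Import polyXY polyrcf ring lra.

Set Implicit Arguments.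
Unset Strict Implicit.
Unset Printing Implicit Defensive.

Local Open Scope classical_set_scope.
Local Open Scope ring_scope.

Import Order.TTheory GRing.Theory Num.Theory.
Import numFieldNormedType.Exports.

(** * Greedy matching of two rows of multiplicities *)

(** Turns a row of counts into a sorted list with one entry per half-branch; the offset [j] serves
    the recursion. *)
Fixpoint expand (j : nat) (l : seq nat) : seq nat :=
  if l is n :: l' then nseq n j ++ expand j.+1 l' else [::].

Lemma expand_ge j l : all (leq j) (expand j l).
Proof.
elim: l j => //= n l IH j; rewrite all_cat all_nseq leqnn orbT /=.
by apply: sub_all (IH j.+1) => k /ltnW.
Qed.

Lemma count_mem_expand j l k :
  count_mem k (expand j l) = if (j <= k)%N then nth 0%N l (k - j) else 0%N.
Proof.
elim: l j => [|n l IH] j /=; first by rewrite nth_nil if_same.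
rewrite count_cat count_nseq IH /=; case: ltngtP => [jk|kj|->].
- by rewrite subnS; case: (k - j)%N (subn_gt0 j k) => //; rewrite jk.
- by [].
- by rewrite mul1n subnn addn0.
Qed.

Lemma sorted_expand j l : sorted leq (expand j l).
Proof.
elim: l j => //= n l IH j; elim: n => //= n.
case: n => [_|n] /=; last by rewrite leqnn.
by rewrite path_sortedE ?IH ?andbT; [apply: sub_all (expand_ge _ _) => k /ltnW|apply: leq_trans].
Qed.

Lemma expand_eq s l : sorted leq s -> (forall k, count_mem k s = nth 0%N l k) ->
  expand 0 l = s.
Proof.
move=> s_sorted sE; apply: (sorted_eq leq_trans anti_leq) => //.
  exact: sorted_expand.
by apply/allP => k _ /=; rewrite count_mem_expand subn0 sE.
Qed.

(** One greedy step: the first index with a positive count heads the list, and decrementing its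
    count removes exactly that head. *)
Lemma expand_head j l (k := find (ltn 0%N) l) : (0 < size (expand j l))%N ->
  expand j l = (j + k)%N :: expand j (set_nth 0%N l k (nth 0%N l k).-1).
Proof.
rewrite {}/k; elim: l j => //= n l IH j; case: n => [|n] /=; last by rewrite addn0.
by move=> /IH ->; rewrite addSnnS.
Qed.

(** Iterating [expand_head], the inner loop consumes the first [m] entries; the size bound keeps
    every [find] in range. *)
Lemma linkE j m l : (m <= size (expand 0 l))%N ->
  (link j m l).1 = [seq (j, k) | k <- take m (expand 0 l)] /\
  expand 0 (link j m l).2 = drop m (expand 0 l).
Proof.
elim: m l => [|m IH] l /=; first by rewrite take0 drop0.
move=> l_gt; have := @expand_head 0 l (leq_ltn_trans (leq0n m) l_gt).
set k := find _ _; set l1 := set_nth _ _ _ _ => lE.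
move: l_gt; rewrite lE /= ltnS => /IH; case: (link j m l1) => e l' /= [-> ->].
by rewrite add0n.
Qed.

(** Each block of [m] copies of [j] meets the next [m] entries on the right, so the greedy loop
    pairs the two lists position by position. *)
Lemma link_rowsE j r l : (size (expand j r) <= size (expand 0 l))%N ->
  link_rows j r l = zip (expand j r) (expand 0 l).
Proof.
elim: r j l => [|m r IH] j l /=; first by case: (expand 0 l).
rewrite size_cat size_nseq => rl.
have /(@linkE j) [] : (m <= size (expand 0 l))%N by apply: leq_trans rl; rewrite leq_addr.
case: (link j m l) => e l' /= -> l'E.
rewrite IH l'E ?size_drop ?leq_subRL //; last by apply: leq_trans rl; rewrite leq_addr.
have s_take : size (take m (expand 0 l)) = m.
  by rewrite size_takel //; apply: leq_trans rl; rewrite leq_addr.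
rewrite -{3}(cat_take_drop m (expand 0 l)) zip_cat ?size_nseq ?s_take //; congr (_ ++ _).
by rewrite -{2}s_take; elim: (take m _) => //= k s ->.
Qed.

(** * Piecewise affine interpolation *)

Section Interpolation.
Variable R : realFieldType.
Implicit Types (l d : nat -> R) (s t y z : R) (n : nat).

(** The affine parameter of [y] on [[s, t]], truncated so that it stays in [[0, 1]] even where the
    nodes [s] and [t] merge. *)
Definition ramp s t y : R := Num.max 0 (Num.min 1 ((y - s) / (t - s))).

Lemma ramp_ge0 s t y : 0 <= ramp s t y.
Proof. by rewrite le_max lexx. Qed.

Lemma ramp_le1 s t y : ramp s t y <= 1.
Proof. by rewrite ge_max ler01 ge_min lexx. Qed.

Lemma ramp_before s t y : s < t -> y <= s -> ramp s t y = 0.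
Proof.
move=> st ys; apply/max_idPl; rewrite ge_min ler_pdivrMr ?subr_gt0 // mul0r.
by rewrite subr_le0 ys orbT.
Qed.

Lemma ramp_after s t y : s < t -> t <= y -> ramp s t y = 1.
Proof.
move=> st ty; rewrite /ramp min_l ?max_r ?ler01 //.
by rewrite ler_pdivlMr ?subr_gt0 // mul1r lerD2r.
Qed.

Lemma ramp_between s t y : s < t -> s <= y <= t -> ramp s t y = (y - s) / (t - s).
Proof.
move=> st /andP[sy yt]; rewrite /ramp min_r ?max_r //.
  by rewrite divr_ge0 ?subr_ge0 // ltW.
by rewrite ler_pdivrMr ?subr_gt0 // mul1r lerD2r.
Qed.

(* The piecewise affine function with value [d k] at the node [l k], constant
   before the first and after the last of the [n] nodes; for [n = 0] it is the
   constant [d 0]. *)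
Definition interp n l d y : R :=
  d 0%N + \sum_(k < n.-1) (d k.+1 - d k) * ramp (l k) (l k.+1) y.

Lemma interpS n l d y :
  interp n.+2 l d y = interp n.+1 l d y + (d n.+1 - d n) * ramp (l n) (l n.+1) y.
Proof. by rewrite /interp /= big_ord_recr addrA. Qed.

Lemma interp_after n l d y : (forall k, (k < n)%N -> l k < l k.+1) ->
  l n <= y -> interp n.+1 l d y = d n.
Proof.
elim: n => [|n IH] l_incr ly; first by rewrite /interp big_ord0 addr0.
have ln : l n < l n.+1 by exact: l_incr.
rewrite interpS IH ?ramp_after //; first by rewrite mulr1 addrC subrK.
  by move=> k kn; apply: l_incr; exact: leqW.
exact: le_trans (ltW ln) ly.
Qed.

Lemma interp_node n l d j : (forall k, (k.+1 < n)%N -> l k < l k.+1) ->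
  (j < n)%N -> interp n l d (l j) = d j.
Proof.
elim: n => // n IH l_incr; rewrite ltnS leq_eqVlt => /predU1P[->|jn].
  by apply: interp_after => // k kn; apply: l_incr.
case: n => // n in IH l_incr jn *.
rewrite interpS IH //; last by move=> k kn; apply: l_incr; exact: leqW.
rewrite ramp_before ?mulr0 ?addr0 //; first exact: l_incr.
(* What remains is [l j <= l n]: an earlier node lies before the last ramp starts. *)
elim: n jn {IH} l_incr => [|n IH]; first by case: j.
rewrite ltnS leq_eqVlt => /predU1P[->//|jn] l_incr.
apply: le_trans (IH jn _) (ltW _); last exact: l_incr.
by move=> k kn; apply: l_incr; exact: leqW.
Qed.

Lemma ltr_glue (f : R -> R) (c : R) :
  (forall y z, y < z -> z <= c -> f y < f z) ->
  (forall y z, y < z -> c <= y -> f y < f z) ->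
  {homo f : y z / y < z}.
Proof.
move=> f_le f_ge y z yz; case: (leP z c) => [|cz]; first exact: f_le.
case: (leP c y) => [|yc]; first exact: f_ge.
by apply: (@lt_trans _ _ (f c)); [apply: f_le|apply: f_ge].
Qed.

(** The map has slope 1 outside the nodes and is affine between them, sending [l k] to [l k + d k].
    The induction adds the last node by gluing at [l n]. *)
Lemma interp_incr n l d :
  (forall k, (k.+1 < n)%N -> l k < l k.+1) ->
  (forall k, (k.+1 < n)%N -> l k + d k < l k.+1 + d k.+1) ->
  {homo (fun y => y + interp n l d y) : y z / y < z}.
Proof.
elim: n => [|n IH] l_incr ld_incr; first by move=> y z; rewrite /interp !big_ord0 ltrD2r.
case: n => [|n] in IH l_incr ld_incr *.
  by move=> y z; rewrite /interp !big_ord0 ltrD2r.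
have ln := l_incr n (leqnn _); have dn := ld_incr n (leqnn _).
have {}IH : {homo (fun y => y + interp n.+1 l d y) : y z / y < z}.
  by apply: IH => k kn; [apply: l_incr|apply: ld_incr]; exact: leqW.
have l_incr' k : (k < n)%N -> l k < l k.+1 by move=> kn; apply: l_incr; exact: leqW.
apply: (@ltr_glue _ (l n)).
  move=> y z yz zl; have yl := le_trans (ltW yz) zl.
  by rewrite !interpS !ramp_before // mulr0 !addr0; exact: IH.
move=> y z yz ly; have lz := le_trans ly (ltW yz).
rewrite !interpS !(@interp_after n) //.
(* Right of [l n] the earlier terms are frozen at [d n], so only the last ramp varies. *)
pose f y := y + (d n + (d n.+1 - d n) * ramp (l n) (l n.+1) y).
rewrite -/(f y) -/(f z).
(* The slope on the last segment, positive because the shifted nodes are ordered. *)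
pose q := (l n.+1 + d n.+1 - (l n + d n)) / (l n.+1 - l n).
have q_gt0 : 0 < q by rewrite divr_gt0 ?subr_gt0.
have f_mid w : l n <= w <= l n.+1 -> f w = l n + d n + q * (w - l n).
  by move=> lw; rewrite /f ramp_between // /q; field; rewrite subr_eq0 gt_eqF.
have f_end w : l n.+1 <= w -> f w = w + d n.+1.
  by move=> lw; rewrite /f ramp_after // mulr1 [d n + _]addrC subrK.
have [zl|/ltW zl] := leP z (l n.+1).
  by rewrite !f_mid ?ly ?lz ?zl ?(le_trans (ltW yz)) // ltrD2l ltr_pM2l // ltrD2r.
have [yl|yl] := leP (l n.+1) y; first by rewrite !f_end // ltrD2r.
rewrite (f_end z) //; apply: (@lt_le_trans _ _ (f (l n.+1))).
  by rewrite !f_mid ?ly ?lexx ?(ltW yl) ?(ltW ln) // ltrD2l ltr_pM2l // ltrD2r.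
by rewrite f_end // lerD2r.
Qed.

End Interpolation.

(** * Limits of branches and the size of fibers *)

Section PlaneCurve.
Variables (R : realType) (g : {poly {poly R}}).
Implicit Types (a b u v w : R) (p : {poly R}) (q : {poly {poly R}}).

Lemma cvg_horner T (F : set_system T) (FF : Filter F) p (f : T -> R) a :
  f z @[z --> F] --> a -> p.[f z] @[z --> F] --> p.[a].
Proof.
move=> fa; elim/poly_ind: p => [|p c IH].
  under eq_cvg do rewrite horner0; rewrite horner0; exact: cvg_cst.
under eq_cvg do rewrite hornerMXaddC; rewrite hornerMXaddC.
by apply: cvgD; [exact: cvgM|exact: cvg_cst].
Qed.

Lemma cvg_horner2 T (F : set_system T) (FF : Filter F) q (f h : T -> R) a b :
  f z @[z --> F] --> a -> h z @[z --> F] --> b ->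
  q.[f z, h z] @[z --> F] --> q.[a, b].
Proof.
move=> fa hb; elim/poly_ind: q => [|q c IH].
  by under eq_cvg do rewrite !horner0; rewrite !horner0; exact: cvg_cst.
under eq_cvg do rewrite hornerMXaddC hornerD hornerM hornerC.
rewrite hornerMXaddC hornerD hornerM hornerC.
by apply: cvgD; [exact: cvgM|exact: cvg_horner].
Qed.

(** Identifies [dy] with the derivative of the restriction to a vertical line, so that Rolle's
    theorem in one variable applies. *)
Lemma dyE a b : (dy g).[a, b] = (g.[a%:P])^`().[b].
Proof.
congr (_.[b]); rewrite (horner_coef_wide _ (size_poly _ _)) horner_coef raddf_sum /=.
apply: eq_bigr => i _; rewrite coef_map_id0 ?raddf0 //.
by rewrite derivM -polyC_exp derivC mulr0 addr0.
Qed.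

(* Two branches with a common limit would, by Rolle's theorem, make [g_y]
   vanish there. *)
Lemma branches_lim_neq (a b : R) rho (phi : 'I_rho -> R -> R) (F : set_system R) (c : R)
    (k l : 'I_rho) v w :
  ProperFilter F -> branches g a b phi ->
  (\forall u \near F, a < u < b) -> u @[u --> F] --> c -> regular_value g c ->
  (k < l)%N -> phi k u @[u --> F] --> v -> phi l u @[u --> F] --> w -> v != w.
Proof.
move=> FF br Fab Fc c_reg kl kv lw; apply/eqP => vw; rewrite -vw in lw => {w vw}.
have cv : curve g (c, v).
  have gF : g.[u, phi k u] @[u --> F] --> g.[c, v] by exact: cvg_horner2.
  have := @closed_cvg _ _ F FF (fun u => g.[u, phi k u]) [set z | z = 0] (@closed_eq _ _) _ _ gF; apply.
  near=> u; suff : curve g (u, phi k u) by [].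
  by apply/(br_roots br); [near: u|exists k].
have dy_neq0 : (dy g).[c, v] != 0.
  by apply/eqP => dy0; apply: c_reg; exists (c, v).
have : \forall p \near (c, v), (dy g).[p.1, p.2] != 0.
  have : (dy g).[p.1, p.2] @[p --> (c, v)] --> (dy g).[c, v].
    by apply: cvg_horner2; [exact: cvg_fst|exact: cvg_snd].
  by move=> /cvgr_neq0; apply.
case/nbhs_ballP => e /= e0 dy_ball.
near F => u; have uab : a < u < b by near: u.
have phi_lt := br_incr br kl uab.
have phi_root j : g.[u%:P].[phi j u] = 0.
  suff : curve g (u, phi j u) by [].
  by apply/(br_roots br) => //; exists j.
have [w] := poly_rolle phi_lt (etrans (phi_root k) (esym (phi_root l))).
rewrite in_itv /= => /andP[kw wl]; rewrite -dyE; apply/eqP.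
apply: (dy_ball (u, w)); split => /=; first by near: u; exact: (cvg_ball Fc).
have : ball v e (phi k u) by near: u; exact: (cvg_ball kv).
have : ball v e (phi l u) by near: u; exact: (cvg_ball lw).
by rewrite /ball /= !ltr_distlC => /andP[_ lv] /andP[vk _]; apply/andP; split; lra.
Unshelve. all: by end_near. Qed.

(** Ensures that rows of width [totdeg g] have room for a whole fiber: its points are roots of
    [g.[a%:P]], whose degree is at most the degree of [g] in [y]. *)
Lemma size_fiber_le_totdeg a (s : seq R) :
  finite_set [set p | curve g p /\ p.1 = a] -> uniq s ->
  (forall v, v \in s -> curve g (a, v)) -> (size s <= totdeg g)%N.
Proof.
move=> fin_a s_uniq s_curve.
have ga_neq0 : g.[a%:P] != 0.
  (* If the restriction vanished, all points [(a, n)] with [n] a natural number would lie in the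
     fiber. *)
  apply/eqP => ga0; apply: infinite_nat.
  suff : finite_set [set n | [set p | curve g p /\ p.1 = a] (a, n%:R)].
    by apply: sub_finite_set => n _; split=> //; rewrite /curve /= ga0 horner0.
  by apply: finite_preimage fin_a => n n' _ _ [] /eqP; rewrite eqr_nat => /eqP.
rewrite -ltnS; apply: (leq_trans (max_poly_roots ga_neq0 _ s_uniq)).
  by apply/allP => v /s_curve; rewrite /curve /= => /eqP.
apply: (leq_trans (max_size_evalC _ _)); rewrite /sizeY.
apply/bigmax_leqP => i _; have [->|gi_neq0] := eqVneq g`_i 0; first by rewrite size_poly0.
rewrite -size_poly_gt0 in gi_neq0; rewrite -(prednK gi_neq0) ltnS.
apply: leq_trans (leq_bigmax i).
have gi_lead : ((size (g`_i)%R).-1 < size (g`_i)%R)%N && (g`_i`_(size g`_i).-1 != 0).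
  by rewrite prednK // leqnn -lead_coefE lead_coef_eq0 -size_poly_gt0.
have /andP[lt_i nz_i] := gi_lead.
apply: leq_trans (leq_bigmax_cond (Ordinal lt_i) nz_i).
exact: leq_addl.
Qed.

End PlaneCurve.

(** * The vertical displacement over one interval *)

Section Displacement.
Variables (R : realType) (a b : R) (rho : nat) (phi : 'I_rho -> R -> R).
Hypothesis ab : a < b.

(* The default value 0 makes the displacement of an index [k >= rho] vanish, so
   that [disp] is 0 when there is no branch at all. *)
Definition branch (k : nat) : R -> R := if insub k is Some j then phi j else cst 0.

(* Branches are unspecified outside [[a, b]]; clamping the abscissa makes [gap]
   continuous on the whole line. *)
Definition clamp (u : R) : R := Num.max a (Num.min b u).

Definition chord (k : nat) (u : R) : R :=
  line_path (branch k a) (branch k b) ((u - a) / (b - a)).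

Definition gap (k : nat) (u : R) : R := branch k (clamp u) - chord k (clamp u).

Definition disp (p : R * R) : R :=
  interp rho (fun k => chord k p.1) (fun k => gap k p.1) p.2.

Lemma branchE (j : 'I_rho) : branch j = phi j.
Proof. by rewrite /branch valK. Qed.

Lemma branch_default k : (rho <= k)%N -> branch k = cst 0.
Proof. by move=> rk; rewrite /branch insubF // ltnNge rk. Qed.

Lemma clamp_itv u : a <= clamp u <= b.
Proof. by rewrite le_max lexx ge_max (ltW ab) ge_min lexx. Qed.

Lemma clamp_id u : a <= u <= b -> clamp u = u.
Proof. by case/andP=> au ub; rewrite /clamp min_r ?max_r. Qed.

Lemma chord_left k : chord k a = branch k a.
Proof. by rewrite /chord subrr mul0r line_path0. Qed.

Lemma chord_right k : chord k b = branch k b.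
Proof. by rewrite /chord divff ?line_path1 // subr_eq0 gt_eqF. Qed.

Lemma gap_in k u : a <= u <= b -> gap k u = branch k u - chord k u.
Proof. by move=> uab; rewrite /gap clamp_id. Qed.

(** Clamping sends [u] to an end of the interval, where chord and branch agree. *)
Lemma gap_out k u : ~~ (a < u < b) -> gap k u = 0.
Proof.
rewrite negb_and -!leNgt /gap /clamp => /orP[ua|bu].
  by rewrite max_l ?ge_min ?ua ?orbT // chord_left subrr.
by rewrite min_l // max_r ?(ltW ab) // chord_right subrr.
Qed.

Lemma clamp_continuous : continuous clamp.
Proof.
by move=> u; apply: continuous_max; [exact: cvg_cst|apply: continuous_min; [exact: cvg_cst|exact: cvg_id]].
Qed.

Lemma continuous_clamp (f : R -> R) :
  {within `[a, b], continuous f} -> continuous (f \o clamp).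
Proof.
move=> /subspace_continuousP f_cont u.
have u_itv : `[a, b]%classic (clamp u) by rewrite /= in_itv clamp_itv.
apply: (@cvg_comp _ _ _ clamp f) (f_cont _ u_itv) => P.
move=> /(@clamp_continuous u) => Pu.
apply: (@filterS _ (nbhs u) _ _ _ _ Pu) => w /=; apply.
by rewrite /= in_itv; exact: clamp_itv.
Qed.

Lemma chord_continuous k : continuous (chord k).
Proof.
move=> u; rewrite /chord /line_path.
have w_cont : (z - a) / (b - a) @[z --> u] --> (u - a) / (b - a).
  by apply: cvgM; [apply: cvgB; [exact: cvg_id|exact: cvg_cst]|exact: cvg_cst].
apply: cvgD; apply: cvgM => //; try exact: cvg_cst.
by apply: cvgB => //; exact: cvg_cst.
Qed.

Lemma disp_out p : ~~ (a < p.1 < b) -> disp p = 0.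
Proof.
move=> p_out; rewrite /disp /interp gap_out // add0r big1 // => k _.
by rewrite !gap_out // subrr mul0r.
Qed.

Hypothesis phi_cont : forall k, {within `[a, b], continuous (phi k)}.
Hypothesis phi_incr : forall (k l : 'I_rho) u, (k < l)%N -> a < u < b -> phi k u < phi l u.
Hypothesis phi_ends : forall k l : 'I_rho, (k < l)%N -> phi k a != phi l a \/ phi k b != phi l b.

Lemma gap_continuous k : continuous (gap k).
Proof.
have [kr|rk] := ltnP k rho.
  apply: (@continuous_clamp (fun u => branch k u - chord k u)) => u.
  apply: cvgB; first by rewrite (branchE (Ordinal kr)); exact: phi_cont.
  by move: u; apply: continuous_subspaceT; exact: chord_continuous.
have -> : gap k = cst 0; last by move=> u; exact: cvg_cst.
by apply/funext => u; rewrite /gap /chord branch_default // /line_path !mulr0 addr0 subrr.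
Qed.

Lemma phi_ends_le (k l : 'I_rho) : (k < l)%N -> phi k a <= phi l a /\ phi k b <= phi l b.
Proof.
move=> kl.
have [_ ka kb] := (continuous_within_itvP _ ab).1 (@phi_cont k).
have [_ la lb] := (continuous_within_itvP _ ab).1 (@phi_cont l).
split; [apply: ler_cvg_to ka la _|apply: ler_cvg_to kb lb _]; near=> u;
  apply/ltW/phi_incr => //; by apply/andP; split; near: u;
  [exact: nbhs_right_gt || exact: nbhs_left_gt| exact: nbhs_right_lt || exact: nbhs_left_lt].
Unshelve. all: by end_near. Qed.

(** The ends are weakly ordered, and strictly so on at least one side by [phi_ends]; at an interior
    abscissa both weights are positive. *)
Lemma chord_incr k u : (k.+1 < rho)%N -> a < u < b -> chord k u < chord k.+1 u.
Proof.
move=> kr /andP[au ub].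
have kr' := ltnW kr.
rewrite /chord /line_path !(branchE (Ordinal kr)) !(branchE (Ordinal kr')).
have kl : (Ordinal kr' < Ordinal kr)%N by [].
have [le_a le_b] := phi_ends_le kl.
have t0 : 0 < (u - a) / (b - a) by rewrite divr_gt0 ?subr_gt0.
have t1 : (u - a) / (b - a) < 1 by rewrite ltr_pdivrMr ?subr_gt0 // mul1r ltrD2r.
move: t0 t1 le_a le_b; set t := _ / _ => t0 t1 le_a le_b.
have t1' : 0 < 1 - t by rewrite subr_gt0.
case: (phi_ends kl) => [neq|neq].
  apply: ltr_leD; last by rewrite ler_pM2l.
  by rewrite ltr_pM2l // lt_neqAle neq.
apply: ler_ltD; first by rewrite ler_pM2l.
by rewrite ltr_pM2l // lt_neqAle neq.
Qed.

Lemma disp_continuous : continuous disp.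
Proof.
have gap1 k : continuous (fun p : R * R => gap k p.1).
  by move=> p; apply: (@continuous_comp _ _ _ fst (gap k)); [exact: cvg_fst|exact: gap_continuous].
move=> p; apply: cvgD; first exact: gap1.
move: p; apply: (continuous_big (@add_continuous R)) => -[k kr] _ p; rewrite /continuous_at /=.
have dgap : gap k.+1 q.1 - gap k q.1 @[q --> p] --> gap k.+1 p.1 - gap k p.1.
  by apply: cvgB; exact: gap1.
have [p_in|p_out] := boolP (a < p.1 < b); last first.
  (* Chords may merge here and the ramp may jump, but it is bounded by 1 while the other factor
     tends to 0. *)
  rewrite !gap_out // subrr mul0r.
  rewrite !gap_out // subrr in dgap.
  have dgap' : `|gap k.+1 q.1 - gap k q.1| @[q --> p] --> 0.
    by rewrite -[0](@normr0 _ R); apply: cvg_norm dgap.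
  apply/norm_cvg0P; apply: (squeeze_cvgr _ _ dgap'); last exact: cvg_cst.
  near=> q; rewrite normr_ge0 normrM /= ler_piMr // ger0_norm ?ramp_ge0 //.
  exact: ramp_le1.
have chord1 j : continuous (fun q : R * R => chord j q.1).
  by move=> q; apply: (@continuous_comp _ _ _ fst (chord j)); [exact: cvg_fst|exact: chord_continuous].
(* The sum has [rho.-1] terms, so [k.+1] still indexes a branch. *)
have kr1 : (k.+1 < rho)%N by case: (rho) kr.
suff : {for p, continuous (fun q : R * R => ramp (chord k q.1) (chord k.+1 q.1) q.2)}.
  exact: cvgM dgap.
apply: continuous_max; first exact: cvg_cst.
apply: continuous_min; first exact: cvg_cst.
apply: cvgM.
  by apply: cvgB; [exact: cvg_snd|exact: chord1].
apply: cvgV; first by rewrite subr_eq0 gt_eqF // chord_incr.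
by apply: cvgB; exact: chord1.
Unshelve. all: by end_near. Qed.

Lemma disp_chord (k : 'I_rho) u : a < u < b -> chord k u + disp (u, chord k u) = phi k u.
Proof.
move=> uab; have /andP[/ltW au /ltW ub] := uab.
rewrite /disp /= (@interp_node _ rho (chord^~ u) (gap^~ u)) //.
  by rewrite gap_in ?au ?ub // branchE addrC subrK.
by move=> j jr; exact: chord_incr.
Qed.

(** Inside the interval the shifted nodes are the branch values, which are strictly ordered;
    elsewhere the map is the identity. *)
Lemma disp_incr u : {homo (fun y => y + disp (u, y)) : y z / y < z}.
Proof.
have [uab|u_out] := boolP (a < u < b); last first.
  by move=> y z yz; rewrite !disp_out // !addr0.
have /andP[/ltW au /ltW ub] := uab.
apply: (@interp_incr R rho (chord^~ u) (gap^~ u)) => k kr; first exact: chord_incr.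
rewrite !gap_in ?au ?ub // ![chord _ u + _]addrC !subrK.
by rewrite (branchE (Ordinal kr)) (branchE (Ordinal (ltnW kr))); exact: phi_incr.
Qed.

End Displacement.

(** * Isotopies along vertical lines *)

Section VerticalIsotopy.
Variables (R : realType) (D : R * R -> R).
Hypothesis D_cont : continuous D.
Hypothesis D_incr : forall u, {homo (fun y => y + D (u, y)) : y z / y < z}.

Definition vmove (t : R) (p : R * R) : R * R := (p.1, p.2 + t * D p).

Lemma vmove_incr t u : 0 <= t <= 1 -> {homo (fun y => (vmove t (u, y)).2) : y z / y < z}.
Proof.
move=> /andP[t0 t1] y z yz /=; have /= := D_incr u yz.
(* [y + t D] is the convex combination of [y] and [y + D] with weights [1 - t] and [t]; the case
   [t = 0] is separate because strictness comes from the second term. *)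
move: (D (u, y)) (D (u, z)) => dy dz yz'; have [<-|t_neq0] := eqVneq 0 t.
  by rewrite !mul0r !addr0.
have : 0 < t * (z + dz - (y + dy)) by rewrite mulr_gt0 ?subr_gt0 // lt_neqAle t_neq0.
have : 0 <= (1 - t) * (z - y) by rewrite mulr_ge0 ?subr_ge0 // ltW.
lra.
Qed.

Lemma vmove_continuous : continuous (fun q : (R * R) * R => vmove q.2 q.1).
Proof.
move=> q.
have p1 : p.1.1 @[p --> q] --> q.1.1.
  by apply: (@continuous_comp _ _ _ fst fst); exact: cvg_fst.
have p2 : p.1.2 @[p --> q] --> q.1.2.
  by apply: (@continuous_comp _ _ _ fst snd); [exact: cvg_fst|exact: cvg_snd].
have pt : p.2 @[p --> q] --> q.2 by exact: cvg_snd.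
have pD : D p.1 @[p --> q] --> D q.1.
  by apply: (@continuous_comp _ _ _ fst D); [exact: cvg_fst|exact: D_cont].
exact: cvg_pair p1 (cvgD p2 (cvgM pt pD)).
Qed.

Lemma cvg_vmove t T (F : set_system T) (FF : Filter F) (f h : T -> R) u y :
  f z @[z --> F] --> u -> h z @[z --> F] --> y ->
  vmove t (f z, h z) @[z --> F] --> vmove t (u, y).
Proof.
move=> fu hy.
have fht : ((f z, h z), t) @[z --> F] --> ((u, y), t).
  exact: cvg_pair (cvg_pair fu hy) (cvg_cst t).
exact: cvg_comp fht (@vmove_continuous ((u, y), t)).
Qed.

Lemma vmove_inj t : 0 <= t <= 1 -> injective (vmove t).
Proof.
move=> t01 [u y] [u' y'] [<-] /= E.
case: (ltgtP y y') => [lt|lt|->//]; have := vmove_incr u t01 lt; by rewrite /= E ltxx.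
Qed.

(* A fiberwise increasing map has a continuous inverse on its image: the points
   [(u, y - e)] and [(u, y + e)] are mapped strictly below and above the image
   of [(u, y)], and this persists for nearby [u]. *)
Lemma vmove_embedding W t : 0 <= t <= 1 -> embedding_on W (vmove t).
Proof.
move=> t01; split; first apply: continuous_subspaceT => q.
  have qt : (p, t) @[p --> q] --> (q, t) by exact: cvg_pair cvg_id (cvg_cst t).
  exact: cvg_comp qt (@vmove_continuous (q, t)).
(* A chosen preimage; off the image its value is arbitrary. *)
pose h (q : R * R) : R * R := get [set p | vmove t p = q].
have hK p : h (vmove t p) = p.
  by apply: (vmove_inj t01); apply: (@getPex _ [set p' | vmove t p' = vmove t p]); exists p.
exists h; split; first by move=> p _; exact: hK.
apply/subspace_continuousP => _ [[u y] Wuy <-]; rewrite /from_subspace /= hK.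
apply/cvg_ballP => e e0.
have q1 : q.1 @[q --> vmove t (u, y)] --> u by exact: cvg_fst.
have q2 : q.2 @[q --> vmove t (u, y)] --> (vmove t (u, y)).2 by exact: cvg_snd.
have vm z : (vmove t (q.1, z)).2 @[q --> vmove t (u, y)] --> (vmove t (u, z)).2.
  have vz : vmove t (q.1, z) @[q --> vmove t (u, y)] --> vmove t (u, z).
    by apply: cvg_vmove => //; exact: cvg_cst.
  by apply: (@cvg_comp _ _ _ _ snd _ _ _ vz); exact: cvg_snd.
have below : \forall q \near vmove t (u, y), 0 < q.2 - (vmove t (q.1, y - e)).2.
  apply: cvgr_gt (cvgB q2 (vm _)) _ _.
  by rewrite subr_gt0 vmove_incr // ltrBlDr ltrDl.
have above : \forall q \near vmove t (u, y), 0 < (vmove t (q.1, y + e)).2 - q.2.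
  apply: cvgr_gt (cvgB (vm _) q2) _ _.
  by rewrite subr_gt0 vmove_incr // ltrDl.
have close : \forall q \near vmove t (u, y), ball u e q.1 by exact: (cvg_ball q1).
near=> q.
(* Continuity within the image concerns only points [q] that have a preimage, whose height is then
   compared with [y - e] and [y + e] by monotonicity. *)
have [[u' y'] _ qE] : [set vmove t p | p in W] q by near: q; exact: withinT.
have : ball u e q.1 by near: q; apply: filterS close => q' ? _.
have : 0 < q.2 - (vmove t (q.1, y - e)).2 by near: q; apply: filterS below => q' ? _.
have : 0 < (vmove t (q.1, y + e)).2 - q.2 by near: q; apply: filterS above => q' ? _.
rewrite -qE hK !subr_gt0 => above' below' uu'.
have vmove_lt y1 y2 : (vmove t (u', y1)).2 < (vmove t (u', y2)).2 -> y1 < y2.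
  apply: contraTT; rewrite -!leNgt le_eqVlt => /predU1P[->//|y21].
  by apply: ltW; exact: (vmove_incr u' t01 y21).
split; first exact: uu'.
rewrite /ball /= ltr_distlC; apply/andP.
by split; apply: vmove_lt; [exact: below'|exact: above'].
Unshelve. all: by end_near. Qed.

Lemma vmove_isotopy (W S T : set (R * R)) :
  (forall u y z, W (u, y) -> W (u, z)) ->
  [set vmove 1 p | p in S] = T -> isotopic_in W S T.
Proof.
move=> W_vert ST; exists (fun q => vmove q.2 q.1); split => //.
- by apply: continuous_subspaceT; exact: vmove_continuous.
- by move=> _ [[[u y] t] [/= Wuy _] <-]; exact: W_vert Wuy.
- by move=> [u y] _; rewrite /vmove /= mul0r addr0.
- by move=> t t01; exact: vmove_embedding.
Qed.

End VerticalIsotopy.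

(** * Rows of counts read as lists of branch ends *)

Section IndexRow.
Variables (R : realType) (d rho : nat) (phi : 'I_rho -> R -> R) (c : R) (s : seq R).
Hypothesis s_sorted : sorted <%R s.
Hypothesis s_size : (size s <= d)%N.
Hypothesis phi_s : forall k, phi k c \in s.
Hypothesis phi_le : forall k l : 'I_rho, (k < l)%N -> phi k c <= phi l c.

(** Both lists are sorted, since branches keep their weak order at [c], and [j] occurs in each as
    often as branches end at the [j]-th point of the fiber. *)
Lemma expand_row (row : 'I_d -> nat) : row_of_counts s (count_at phi c) row ->
  expand 0 [seq row j | j <- enum 'I_d] = [seq index (phi k c) s | k <- enum 'I_rho].
Proof.
move=> rowE; apply: expand_eq.
  apply: (@homo_sorted _ _ _ (fun k l : 'I_rho => (k < l)%N)).
    move=> k l /phi_le; apply: contraTT; rewrite -ltnNge -ltNge => lk.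
    have := sorted_ltn_nth lt_trans 0 s_sorted _ _ _ _ lk.
    by rewrite !nth_index //; apply; rewrite inE index_mem.
  by have := iota_ltn_sorted 0 rho; rewrite -val_enum_ord sorted_map.
move=> j; rewrite count_map.
have [j_lt|dj] := ltnP j d; last first.
  (* Past the width [d] the row reads as the default 0, and no index gets there since
     [size s <= d]. *)
  rewrite nth_default; last by rewrite size_map size_enum_ord.
  apply/eqP.
  rewrite -leqn0 leqNgt -has_count; apply/hasPn => k _ /=.
  by rewrite neq_ltn (leq_trans _ (leq_trans s_size dj)) // index_mem.
rewrite (nth_map (Ordinal j_lt)) ?size_enum_ord // rowE nth_enum_ord // /count_at cardsE.
rewrite cardE [in RHS]/enum_mem size_filter -enumT.
case: ifP => js; last first.
  apply/eqP; rewrite -leqn0 leqNgt -has_count; apply/hasPn => k _ /=.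
  by rewrite neq_ltn (leq_trans (_ : _ < size s)%N) ?index_mem // leqNgt js.
apply: eq_count => k /=; apply/eqP/eqP => [<-|]; first by rewrite nth_index.
by move=> ->; rewrite index_uniq // lt_sorted_uniq.
Qed.

End IndexRow.

(** * Intervals of a partition *)

Lemma lendE m (i : 'I_m) : lend i = i :> nat. Proof. by []. Qed.

Lemma rendE m (i : 'I_m) : rend i = i.+1 :> nat.
Proof. exact: lift0. Qed.

Section Partition.
Variables (R : realType) (m : nat) (x : 'I_m.+1 -> R).
Hypothesis x_incr : forall i j : 'I_m.+1, (i < j)%N -> x i < x j.

Lemma partition_le (i j : 'I_m.+1) : (i <= j)%N -> x i <= x j.
Proof. by rewrite leq_eqVlt => /predU1P[/val_inj->//|/x_incr/ltW]. Qed.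

Lemma partition_inj : injective x.
Proof.
move=> i j xij; apply/val_inj; case: (ltngtP i j) => // /x_incr; by rewrite xij ltxx.
Qed.

(** Take the least [j] with [u <= x j]: either equality holds or [u] is inside the interval ending
    at [x j]. *)
Lemma partition_locate u : x ord0 <= u <= x ord_max ->
  (exists j, u = x j) \/ exists i, x (lend i) < u < x (rend i).
Proof.
case/andP=> xu ux.
case: (@arg_minnP _ ord_max (fun j => u <= x j) (@nat_of_ord m.+1) ux) => j uj j_min.
have [uE|u_neq] := eqVneq u (x j); first by left; exists j.
case: (unliftP ord0 j) => [i jE|jE]; last first.
  by case/eqP: u_neq; apply/eqP; rewrite eq_le uj jE xu.
right; exists i; rewrite -[rend i]jE [u < _]lt_neqAle u_neq uj !andbT ltNge; apply/negP => ui.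
have := j_min _ ui.
by rewrite jE lift0 lendE ltnn.
Qed.

Lemma partition_separated (i : 'I_m) (j : 'I_m.+1) : ~~ (x (lend i) < x j < x (rend i)).
Proof.
rewrite negb_and -!leNgt; have [ji|ij] := leqP j i; first by rewrite partition_le.
by rewrite (@partition_le (rend i) j) ?orbT // rendE.
Qed.

Lemma partition_disjoint (i j : 'I_m) u :
  x (lend i) < u < x (rend i) -> x (lend j) < u < x (rend j) -> i = j.
Proof.
move=> /andP[iu ui] /andP[ju uj]; apply/val_inj.
case: (ltngtP i j) => // [ij|ji].
  have /partition_le : (rend i <= lend j)%N by rewrite rendE.
  by move=> /(lt_le_trans ui) /lt_trans /(_ ju); rewrite ltxx.
have /partition_le : (rend j <= lend i)%N by rewrite rendE.
by move=> /(lt_le_trans uj) /lt_trans /(_ iu); rewrite ltxx.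
Qed.

End Partition.

(** * Assembly over the whole strip *)

Section Assembly.
Variables (R : realType) (g : {poly {poly R}}).
Variables (m : nat) (x : 'I_m.+1 -> R).
Variables (rho : 'I_m -> nat) (phi : forall i : 'I_m, 'I_(rho i) -> R -> R).
Hypothesis hphi : branch_system g x phi.
Hypothesis hx : good_partition g x.

Let x_incr := gpa_incr hx.

Lemma interval_gt0 i : x (lend i) < x (rend i).
Proof. by apply: x_incr; rewrite rendE. Qed.

(** If the left end is critical, a good partition makes the next point, the right end, regular. *)
Lemma interval_regular i : regular_value g (x (lend i)) \/ regular_value g (x (rend i)).
Proof.
have [crit|] := pselect (critical_value g (x (lend i))); last by left.
have [j [j' [j'' [j'E j''E xE _ reg]]]] := gpa_critical hx crit.
right; suff -> : rend i = j'' by [].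
by apply/ord_inj; rewrite rendE j''E -(partition_inj x_incr xE).
Qed.

(** At the regular end the values are limits of the branches by continuity, and [branches_lim_neq]
    separates them. *)
Lemma interval_ends i (k l : 'I_(rho i)) : (k < l)%N ->
  phi k (x (lend i)) != phi l (x (lend i)) \/ phi k (x (rend i)) != phi l (x (rend i)).
Proof.
move=> kl; have [br cont _ _] := hphi i; have ab := interval_gt0 i.
have [_ ka kb] := (continuous_within_itvP _ ab).1 (@cont k).
have [_ la lb] := (continuous_within_itvP _ ab).1 (@cont l).
case: (interval_regular i) => reg; [left|right].
  apply: (branches_lim_neq _ br _ _ reg kl ka la); last exact: cvg_at_right_filter.
  by near=> u; apply/andP; split; near: u; [exact: nbhs_right_gt|exact: nbhs_right_lt].
apply: (branches_lim_neq _ br _ _ reg kl kb lb); last exact: cvg_at_left_filter.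
by near=> u; apply/andP; split; near: u; [exact: nbhs_left_gt|exact: nbhs_left_lt].
Unshelve. all: by end_near. Qed.

(** A sum instead of a case distinction: each term vanishes off its own open interval, so at most
    one is nonzero at a point, and continuity passes to the finite sum. *)
Definition total_disp (p : R * R) : R :=
  \sum_(i < m) disp (x (lend i)) (x (rend i)) (@phi i) p.

Lemma total_disp_in i p : x (lend i) < p.1 < x (rend i) ->
  total_disp p = disp (x (lend i)) (x (rend i)) (@phi i) p.
Proof.
move=> p_in; rewrite /total_disp (bigD1 i) //= big1 ?addr0 // => j ji.
apply: disp_out; first exact: interval_gt0.
apply: contra ji => p_in'; apply/eqP; exact: (partition_disjoint x_incr p_in' p_in).
Qed.

Lemma total_disp_at j y : total_disp (x j, y) = 0.
Proof.
rewrite /total_disp big1 // => i _; apply: disp_out; first exact: interval_gt0.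
exact: partition_separated.
Qed.

Lemma total_disp_continuous : continuous total_disp.
Proof.
apply: (continuous_big (@add_continuous R)) => i _.
have [br cont _ _] := hphi i; apply: disp_continuous => //.
- exact: interval_gt0.
- exact: br_incr br.
- exact: interval_ends.
Qed.

Lemma total_disp_incr u : {homo (fun y => y + total_disp (u, y)) : y z / y < z}.
Proof.
have [[i u_in]|u_out] := pselect (exists i, x (lend i) < u < x (rend i)).
  move=> y z yz; rewrite !(total_disp_in (i := i)) //.
  have [br cont _ _] := hphi i; apply: disp_incr => //.
  - exact: interval_gt0.
  - exact: br_incr br.
  - exact: interval_ends.
move=> y z yz; rewrite /total_disp !big1 ?addr0 // => i _;
  apply: disp_out => /=; rewrite ?interval_gt0 //; apply/negP => u_in; by apply: u_out; exists i.
Qed.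

Lemma chord_total_disp i (k : 'I_(rho i)) u : x (lend i) < u < x (rend i) ->
  let c := chord (x (lend i)) (x (rend i)) (@phi i) k u in
  c + total_disp (u, c) = phi k u.
Proof.
move=> u_in c; rewrite (total_disp_in (i := i)) //.
have [br cont _ _] := hphi i; apply: disp_chord => //.
- exact: interval_gt0.
- exact: br_incr br.
- exact: interval_ends.
Qed.

Lemma line_path_ratio (a b t : R) : a < b -> (line_path a b t - a) / (b - a) = t.
Proof. by move=> ab; rewrite /line_path; field; rewrite subr_eq0 gt_eqF. Qed.

Lemma line_path_at_ratio (a b u : R) : a < b -> line_path a b ((u - a) / (b - a)) = u.
Proof. by move=> ab; rewrite /line_path; field; rewrite subr_eq0 gt_eqF. Qed.

Lemma chord_segment i (k : 'I_(rho i)) p :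
  segment (x (lend i), phi k (x (lend i))) (x (rend i), phi k (x (rend i))) p <->
  x (lend i) <= p.1 <= x (rend i) /\
  p.2 = chord (x (lend i)) (x (rend i)) (@phi i) k p.1.
Proof.
have ab := interval_gt0 i; move: ab; set a := x _; set b := x _ => ab.
have ba0 : 0 < b - a by rewrite subr_gt0.
split=> [[t]|[]].
  rewrite /= in_itv /= => /andP[t0 t1] <- /=; split.
    by rewrite /line_path; apply/andP; split; nra.
  rewrite /chord !branchE; congr line_path.
  by rewrite line_path_ratio.
(* The segment parameter is the relative position of the abscissa. *)
case: p => u v /= /andP[au ub] ->; exists ((u - a) / (b - a)).
  by rewrite /= in_itv /= divr_ge0 ?subr_ge0 // ?ler_pdivrMr ?mul1r ?lerD2r // ltW.
congr pair; last by rewrite /chord !branchE.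
by rewrite line_path_at_ratio.
Qed.

Hypothesis hg : general_position g.
Variables (Y : 'I_m.+1 -> seq R) (Lh Rh : 'M[nat]_(m.+1, totdeg g)).
Hypothesis hdata : curve_data x phi Y Lh Rh.

Lemma branch_ends_le i (k l : 'I_(rho i)) : (k < l)%N ->
  phi k (x (lend i)) <= phi l (x (lend i)) /\ phi k (x (rend i)) <= phi l (x (rend i)).
Proof.
have [br cont _ _] := hphi i.
by apply: (phi_ends_le (interval_gt0 i) cont); exact: br_incr br.
Qed.

(** Both rows expand to the ends of the branches listed in the same order, so pairing by position
    joins the two ends of each branch. *)
Lemma link_rows_branches i :
  link_rows 0 (row_seq Rh (lend i)) (row_seq Lh (rend i)) =
  [seq (index (phi k (x (lend i))) (Y (lend i)), index (phi k (x (rend i))) (Y (rend i)))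
  | k <- enum 'I_(rho i)].
Proof.
have [_ _ on_left on_right] := hphi i.
have Y_size j : (size (Y j) <= totdeg g)%N.
  apply: (size_fiber_le_totdeg (gp_fibers hg (x j))); first exact: lt_sorted_uniq (cd_sorted hdata j).
  by move=> v /(cd_fiber hdata).
have RE : expand 0 (row_seq Rh (lend i)) =
    [seq index (phi k (x (lend i))) (Y (lend i)) | k <- enum 'I_(rho i)].
  apply: expand_row (cd_right hdata i) => //; first exact: cd_sorted hdata _.
    by move=> k; apply/(cd_fiber hdata).
  by move=> k l /branch_ends_le[].
have LE : expand 0 (row_seq Lh (rend i)) =
    [seq index (phi k (x (rend i))) (Y (rend i)) | k <- enum 'I_(rho i)].
  apply: expand_row (cd_left hdata i) => //; first exact: cd_sorted hdata _.
    by move=> k; apply/(cd_fiber hdata).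
  by move=> k l /branch_ends_le[].
by rewrite link_rowsE RE LE ?size_map // zip_map.
Qed.

Lemma mem_edges e : e \in edges (data_graph x Y Lh Rh) <->
  exists i (k : 'I_(rho i)),
    e = ((x (lend i), phi k (x (lend i))), (x (rend i), phi k (x (rend i)))).
Proof.
have nthY i (k : 'I_(rho i)) :
    (Y (lend i))`_(index (phi k (x (lend i))) (Y (lend i))) = phi k (x (lend i)) /\
    (Y (rend i))`_(index (phi k (x (rend i))) (Y (rend i))) = phi k (x (rend i)).
  have [_ _ on_left on_right] := hphi i.
  by split; rewrite nth_index //; apply/(cd_fiber hdata).
split.
  case/allpairsPdep => i [jk [_]]; rewrite link_rows_branches => /mapP[k _ ->] ->.
  by exists i, k; rewrite /=; have [-> ->] := nthY i k.
case=> i [k ->]; apply/allpairsPdep.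
exists i, (index (phi k (x (lend i))) (Y (lend i)), index (phi k (x (rend i))) (Y (rend i))).
split; first by rewrite mem_enum.
  by rewrite link_rows_branches; apply: map_f; rewrite mem_enum.
by rewrite /=; have [-> ->] := nthY i k.
Qed.

Lemma mem_vertices p : p \in vertices (data_graph x Y Lh Rh) <->
  exists j, p.1 = x j /\ curve g (x j, p.2).
Proof.
split.
  by case/allpairsPdep => j [v [_ /(cd_fiber hdata) jv ->]]; exists j.
case: p => u v [j [/= -> jv]]; apply/allpairsPdep; exists j, v.
by split => //; [rewrite mem_enum|apply/(cd_fiber hdata)].
Qed.

Lemma vmove_realization :
  [set vmove total_disp 1 p | p in realization (data_graph x Y Lh Rh)] =
  curve g `&` strip (x ord0) (x ord_max).
Proof.
have strip_x j v : strip (x ord0) (x ord_max) (x j, v).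
  by rewrite /strip /= !partition_le // leq_ord.
have at_x j v : vmove total_disp 1 (x j, v) = (x j, v).
  by rewrite /vmove total_disp_at mulr0 addr0.
apply/seteqP; split=> [_ [[u v] uvG <-]|[u v] [uv_curve uv_strip]].
  case: uvG => [/mem_vertices /= [j [-> jv]]|[e /mem_edges[i [k ->]] /chord_segment /=]].
    by rewrite at_x.
  have [br _ on_left on_right] := hphi i.
  (* The ends of an edge stay fixed and lie on the curve; its interior points move from chord to
     branch. *)
  case=> /andP[]; rewrite le_eqVlt => /predU1P[<- _ ->|iu].
    rewrite chord_left branchE at_x; split=> //; exact: on_left.
  rewrite le_eqVlt => /predU1P[-> ->|ui ->].
    by rewrite chord_right ?interval_gt0 // branchE at_x; split=> //; exact: on_right.
  have u_in : x (lend i) < u < x (rend i) by rewrite iu ui.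
  rewrite /vmove /= mul1r chord_total_disp //; split; first by apply/(br_roots br) => //; exists k.
  rewrite /strip /= (le_trans _ (ltW iu)) ?partition_le //.
  by rewrite (le_trans (ltW ui)) // partition_le // leq_ord.
(* Conversely, a curve point over a partition point is a fixed vertex; any other lies on a branch
   and comes from the chord of that branch. *)
case: (partition_locate uv_strip) => /= [[j uE]|[i u_in]].
  exists (u, v); last by rewrite uE at_x.
  by left; apply/mem_vertices; exists j; rewrite -uE.
have [br _ _ _] := hphi i; have [k vE] := (br_roots br v u_in).1 uv_curve.
exists (u, chord (x (lend i)) (x (rend i)) (@phi i) k u).
  right; exists ((x (lend i), phi k (x (lend i))), (x (rend i), phi k (x (rend i)))).
    by apply/mem_edges; exists i, k.
  apply/chord_segment; split=> //=.
  by case/andP: u_in => /ltW -> /ltW ->.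
by rewrite /vmove /= mul1r chord_total_disp // -vE.
Qed.

End Assembly.

Theorem theorem7 (R : realType) (g : {poly {poly R}})
  (hg : general_position g)
  (m : nat) (x : 'I_m.+1 -> R)
  (rho : 'I_m -> nat) (phi : forall i : 'I_m, 'I_(rho i) -> R -> R)
  (hphi : branch_system g x phi)
  (Y : 'I_m.+1 -> seq R) (Lh Rh : 'M[nat]_(m.+1, totdeg g))
  (hdata : curve_data x phi Y Lh Rh) :
  isotopic_in (strip (x ord0) (x ord_max))
    (realization (data_graph x Y Lh Rh))
    (curve g `&` strip (x ord0) (x ord_max)).
Proof.
have hx := cd_partition hdata.
apply: (@vmove_isotopy _ (total_disp x phi)).
- exact: total_disp_continuous hphi hx.
- exact: total_disp_incr hphi hx.
(* Membership in the strip depends only on the abscissa. *)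
- by [].
- exact (vmove_realization hphi hx hg hdata).
Qed.
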